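(* Each closed Lie subalgebra $\mathcal{M}$ of a strongly $\mathcal{F}$-semisimple Banach Lie algebra $\mathcal{L}$ is strongly $\mathcal{F}$-semisimple.
   Context: A Banach Lie algebra is a complex Lie algebra $\mathcal{L}$ which is a Banach space in a norm such that, for some $t_{\mathcal{L}}>0$, $\|[a,b]\|\leq t_{\mathcal{L}}\|a\|\|b\|$ for all $a,b\in\mathcal{L}$. For a non-empty family $G$ of closed subspaces of a Banach space, $\mathfrak{p}(G)=\bigcap_{Y\in G}Y$ and $\mathfrak{s}(G)$ is the closed linear span of $\bigcup_{Y\in G}Y$. $G$ is complete if $G=\{\mathfrak{p}(G'):\varnothing\neq G'\subseteq G\}\cup\{\mathfrak{s}(G)\}$ and $G=\{\mathfrak{s}(G'):\varnothing\neq G'\subseteq G\}\cup\{\mathfrak{p}(G)\}$. $G$ is a lower finite-gap family if for each $Z\in G$ with $Z\neq\mathfrak{p}(G)$ there is $Y\in G$ with $Y\subset Z$ and $0<\dim(Z/Y)<\infty$. A chain is a family $C$ totally ordered by inclusion; it is between $A$ and $B$ if $\mathfrak{p}(C)=A$ and $\mathfrak{s}(C)=B$. A Banach Lie algebra $\mathcal{L}$ is strongly $\mathcal{F}$-semisimple if there is a complete, lower finite-gap chain of closed Lie ideals of $\mathcal{L}$ between $\{0\}$ and $\mathcal{L}$. *)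

(* Defs.v *)
From HB Require Import structures.
From mathcomp Require Import all_boot all_order all_algebra.
From mathcomp Require Import complex.
From mathcomp Require Import all_classical all_reals all_analysis.

Set Implicit Arguments.
Unset Strict Implicit.
Unset Printing Implicit Defensive.

Import Order.TTheory GRing.Theory Num.Theory.
Import numFieldNormedType.Exports.

Local Open Scope classical_set_scope.
Local Open Scope ring_scope.
Local Open Scope complex_scope.

(* The field of complex numbers is [R[i]] for [R : realType]. Norms take their
   values in [R[i]], where [0 < t] entails that [t] is real. *)
HB.mixin Record CompleteNormedModule_isBanachLie (R : realType) L
    & CompleteNormedModule R[i] L := {
  lie : L -> L -> L;
  lieDl : forall a b c : L, lie (a + b) c = lie a c + lie b c;
  lieZl : forall (k : R[i]) (a b : L), lie (k *: a) b = k *: lie a b;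
  lieDr : forall a b c : L, lie a (b + c) = lie a b + lie a c;
  lieZr : forall (k : R[i]) (a b : L), lie a (k *: b) = k *: lie a b;
  liexx : forall a : L, lie a a = 0;
  lie_jacobi : forall a b c : L,
    lie a (lie b c) + lie b (lie c a) + lie c (lie a b) = 0;
  lie_bounded : exists2 t : R[i], 0 < t &
    forall a b : L, `|lie a b| <= t * `|a| * `|b|
}.

#[short(type="banachLieType")]
HB.structure Definition BanachLie (R : realType) :=
  {L of CompleteNormedModule R[i] L & CompleteNormedModule_isBanachLie R L}.

Section Families.
Context {K : numFieldType} {V : normedModType K}.
Implicit Types (Y Z : set V) (G C : set (set V)).

Definition closed_subspace Y := closed Y /\ submod_closed (mem Y).

Definition linear_span (A : set V) : set V :=
  smallest [set Y : set V | submod_closed (mem Y)] A.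

Definition meet_family G : set V := \bigcap_(Y in G) Y.

Definition join_family G : set V := closure (linear_span (\bigcup_(Y in G) Y)).

Definition subfamily G : set (set (set V)) := [set G' | G' !=set0 /\ G' `<=` G].

Definition complete_family G :=
  G = [set meet_family G' | G' in subfamily G] `|` [set join_family G] /\
  G = [set join_family G' | G' in subfamily G] `|` [set meet_family G].

(* [dim (Z / Y) = n]: the classes modulo [Y] of some [e_0, .., e_(n-1)] in [Z]
   form a basis of [Z / Y]. *)
Definition quotient_dim Z Y (n : nat) :=
  exists e : 'I_n -> V, (forall i, Z (e i)) /\
    forall z, Z z -> exists! c : 'rV[K]_n, Y (z - \sum_(i < n) c 0 i *: e i).

Definition lower_finite_gap G :=
  forall Z, G Z -> Z <> meet_family G ->
    exists Y, [/\ G Y, Y `<=` Z & exists n, (0 < n)%N /\ quotient_dim Z Y n].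

Definition chain_family C :=
  forall Y Z, C Y -> C Z -> Y `<=` Z \/ Z `<=` Y.

Definition between C (A B : set V) := meet_family C = A /\ join_family C = B.

End Families.

Section BanachLieTheory.
Context {R : realType}.
Implicit Type L : banachLieType R.

Definition closed_lie_ideal L (I : set L) :=
  closed_subspace I /\ forall a x : L, I x -> I (lie a x).

Definition strongly_F_semisimple L :=
  exists C : set (set L),
    [/\ C !=set0 /\ C `<=` @closed_lie_ideal L,
        chain_family C, complete_family C, lower_finite_gap C
      & between C [set 0] setT].

Record closedLieSubalgebra L := ClosedLieSubalgebra {
  subalg_set :> set L;
  subalg_closed_subspace : closed_subspace subalg_set;
  subalg_lie : forall a b, subalg_set a -> subalg_set b -> subalg_set (lie a b)
}.

End BanachLieTheory.

(* A closed Lie subalgebra as a Banach Lie algebra of its own, for the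
   restricted norm and bracket. *)
Section SubBanachLie.
Context (R : realType) (L : banachLieType R) (M : closedLieSubalgebra L).

Definition subalg_pred : {pred L} := mem (subalg_set M).

Record subalg := Subalg { subalg_val : L; _ : subalg_val \in subalg_pred }.

HB.instance Definition _ := [isSub for subalg_val].
HB.instance Definition _ := [Choice of subalg by <:].

HB.instance Definition _ := GRing.isSubmodClosed.Build _ _ subalg_pred
  (subalg_closed_subspace M).2.
HB.instance Definition _ := [SubChoice_isSubLmodule of subalg by <:].

Let subalg_norm (x : subalg) : R[i] := `|val x|.

Let subalg_normD (x y : subalg) :
  subalg_norm (x + y) <= subalg_norm x + subalg_norm y.
Proof. by rewrite /subalg_norm raddfD ler_normD. Qed.

Let subalg_normZ (k : R[i]) (x : subalg) :
  subalg_norm (k *: x) = `|k| * subalg_norm x.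
Proof. by rewrite /subalg_norm linearZ normrZ. Qed.

Let subalg_norm0_eq0 (x : subalg) : subalg_norm x = 0 -> x = 0.
Proof. by move/eqP; rewrite normr_eq0 => /eqP x0; apply: val_inj. Qed.

HB.instance Definition _ := @Lmodule_isNormed.Build R[i] subalg
  subalg_norm subalg_normD subalg_normZ subalg_norm0_eq0.

Lemma subalg_normE (x : subalg) : `|x| = `|val x|.
Proof. by []. Qed.

Let subalg_cauchy_cvg (F : set_system subalg) :
  ProperFilter F -> cauchy F -> cvg F.
Proof.
move=> FF /cauchy_ballP Fc.
pose vF : set_system L := val @ F.
have FvF : ProperFilter vF by apply: fmap_proper_filter.
have /cauchy_cvg/cvg_ex[l vFl] : cauchy vF.
  apply/cauchyP => e e0; have /cauchyP/(_ e e0)[x Fx] : cauchy F.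
    exact/cauchy_ballP.
  exists (val x); rewrite /vF /=; apply: filterS Fx => y /=.
  by rewrite -!ball_normE /= subalg_normE raddfB.
have Ml : subalg_set M l.
  apply: (subalg_closed_subspace M).1 => B /vFl vFB.
  have FB : F (val @^-1` B) := vFB.
  have [x Bx] := filter_ex FB.
  by exists (val x); split=> //; exact: set_mem (valP x).
apply/cvg_ex; exists (Subalg (mem_set Ml)).
apply/fcvgrPdist_lt => e e0.
have /cvgrPdist_lt/(_ e e0) := vFl.
by apply: filterS => x; rewrite subalg_normE raddfB.
Qed.

HB.instance Definition _ := Uniform_isComplete.Build subalg subalg_cauchy_cvg.

Lemma subalg_lie_mem (x y : subalg) : lie (val x) (val y) \in subalg_pred.
Proof. by apply/mem_set/subalg_lie; exact: set_mem (valP _). Qed.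

Definition sub_lie (x y : subalg) : subalg := Subalg (subalg_lie_mem x y).

Let sub_lieDl (a b c : subalg) : sub_lie (a + b) c = sub_lie a c + sub_lie b c.
Proof. by apply: val_inj; rewrite /= lieDl. Qed.

Let sub_lieZl (k : R[i]) (a b : subalg) :
  sub_lie (k *: a) b = k *: sub_lie a b.
Proof. by apply: val_inj; rewrite /= lieZl. Qed.

Let sub_lieDr (a b c : subalg) : sub_lie a (b + c) = sub_lie a b + sub_lie a c.
Proof. by apply: val_inj; rewrite /= lieDr. Qed.

Let sub_lieZr (k : R[i]) (a b : subalg) :
  sub_lie a (k *: b) = k *: sub_lie a b.
Proof. by apply: val_inj; rewrite /= lieZr. Qed.

Let sub_liexx (a : subalg) : sub_lie a a = 0.
Proof. by apply: val_inj; rewrite /= liexx. Qed.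

Let sub_lie_jacobi (a b c : subalg) :
  sub_lie a (sub_lie b c) + sub_lie b (sub_lie c a)
    + sub_lie c (sub_lie a b) = 0.
Proof. by apply: val_inj; rewrite /= lie_jacobi. Qed.

Let sub_lie_bounded : exists2 t : R[i], 0 < t &
  forall a b : subalg, `|sub_lie a b| <= t * `|a| * `|b|.
Proof.
have [t t0 tP] := @lie_bounded R L.
by exists t => // a b; rewrite !subalg_normE; exact: tP.
Qed.

HB.instance Definition _ := CompleteNormedModule_isBanachLie.Build R subalg
  sub_lieDl sub_lieZl sub_lieDr sub_lieZr sub_liexx sub_lie_jacobi
  sub_lie_bounded.

End SubBanachLie.

(* Main.v *)
(* Traces [I `&` M] of the ideals of a suitable chain [C] of [L] form a suitable
   chain of [M]. Completeness under meets is immediate. For joins, the lower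
   finite-gap property forces every non-empty subfamily of [C] to have a
   greatest element: if [J] is its join and [Y] the element of finite
   codimension below [J], the members between [Y] and [J] satisfy the ascending
   chain condition. Greatest elements survive intersection with [M], whereas
   joins of arbitrary subspaces need not. For the gaps, apply the hypothesis to
   the smallest ideal [I] having a given trace on [M]. *)
From HB Require Import structures.
Require Import Defs.
From mathcomp Require Import all_boot all_order all_algebra.
From mathcomp Require Import all_classical all_reals all_analysis.

Set Implicit Arguments.
Unset Strict Implicit.
Unset Printing Implicit Defensive.

Import GRing.Theory.
Import numFieldNormedType.Exports.

Local Open Scope classical_set_scope.
Local Open Scope ring_scope.

(** * Subspaces, linear combinations and row spaces *)

Section Submodules.
Context {K : numFieldType} {V : lmodType K}.
Implicit Types (Y Z : set V).

Lemma submod_closed_setP Y : submod_closed (mem Y) <->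
  Y 0 /\ forall (k : K) (u v : V), Y u -> Y v -> Y (k *: u + v).
Proof.
split=> [[Y0 YP]|[Y0 YP]]; split.
- exact: set_mem.
- by move=> k u v /mem_set Yu /mem_set Yv; apply: set_mem; exact: YP.
- exact: mem_set.
- by move=> k u v /set_mem Yu /set_mem Yv; apply/mem_set/YP.
Qed.

Lemma submod0 Y : submod_closed (mem Y) -> Y 0.
Proof. by case/submod_closed_setP. Qed.

Lemma submodD Y u v : submod_closed (mem Y) -> Y u -> Y v -> Y (u + v).
Proof.
by case/submod_closed_setP => _ YP Yu Yv; rewrite -[u]scale1r; exact: YP.
Qed.

Lemma submodZ Y k u : submod_closed (mem Y) -> Y u -> Y (k *: u).
Proof.
by case/submod_closed_setP => Y0 YP Yu; rewrite -[_ *: _]addr0; exact: YP.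
Qed.

Lemma submodN Y u : submod_closed (mem Y) -> Y u -> Y (- u).
Proof. by move=> Ys Yu; rewrite -scaleN1r; exact: submodZ. Qed.

Lemma submodB Y u v : submod_closed (mem Y) -> Y u -> Y v -> Y (u - v).
Proof. by move=> Ys Yu Yv; apply: submodD => //; exact: submodN. Qed.

Lemma submod_sum Y n (F : 'I_n -> V) :
  submod_closed (mem Y) -> (forall i, Y (F i)) -> Y (\sum_i F i).
Proof.
move=> Ys YF; elim/big_ind: _ => //; first exact: submod0.
by move=> u v; exact: submodD.
Qed.

(** Names the sum inside [quotient_dim], so that it becomes a linear map along which subspaces can
    be pulled back to coordinates. *)
Definition lincomb n (e : 'I_n -> V) (c : 'rV[K]_n) : V :=
  \sum_(i < n) c 0 i *: e i.

Lemma lincomb_linear n (e : 'I_n -> V) : linear (lincomb e).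
Proof.
move=> k c d; rewrite /lincomb scaler_sumr -big_split; apply: eq_bigr => i _ /=.
by rewrite !mxE scalerDl scalerA.
Qed.

Lemma lincomb0 n (e : 'I_n -> V) : lincomb e 0 = 0.
Proof. by rewrite /lincomb big1// => i _; rewrite mxE scale0r. Qed.

Lemma lincomb_mulmx k n (e : 'I_n -> V) (d : 'rV[K]_k) (A : 'M[K]_(k, n)) :
  lincomb e (d *m A) = \sum_i d 0 i *: lincomb e (row i A).
Proof.
rewrite /lincomb; under eq_bigr do rewrite mxE scaler_suml.
rewrite exchange_big; apply: eq_bigr => i _; rewrite scaler_sumr.
by apply: eq_bigr => j _; rewrite mxE scalerA.
Qed.

HB.instance Definition _ n (e : 'I_n -> V) :=
  GRing.isLinear.Build K 'rV[K]_n V *:%R (lincomb e) (@lincomb_linear n e).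

End Submodules.

Lemma submod_preimage (K : numFieldType) (V W : lmodType K)
    (f : {linear W -> V}) (Y : set V) :
  submod_closed (mem Y) -> submod_closed (mem (f @^-1` Y)).
Proof.
move=> /submod_closed_setP[Y0 YP]; apply/submod_closed_setP; split=> /=.
  by rewrite linear0.
by move=> k u v Yu Yv /=; rewrite linearP; exact: YP.
Qed.

(** Ranks are bounded by [n], so a row space contained in some member of [F] can be chosen of
    maximal rank. Serves as the ascending chain condition and, for a singleton [F], as the existence
    of a basis. *)
Lemma rowspace_maximal (K : numFieldType) n (F : set (set 'rV[K]_n)) :
    F !=set0 -> (forall P, F P -> submod_closed (mem P)) ->
  exists k (A : 'M[K]_(k, n)), [/\ row_free A, F [set v | (v <= A)%MS] &
    forall Q, F Q -> [set v | (v <= A)%MS] `<=` Q ->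
      Q `<=` [set v | (v <= A)%MS]].
Proof.
move=> [P0 FP0] Fs.
pose p k := `[< exists P (A : 'M[K]_n),
  [/\ F P, \rank A = k & forall v : 'rV_n, (v <= A)%MS -> P v] >].
have ep : exists k, p k.
  exists 0%N; apply/asboolP; exists P0, 0; split; rewrite ?mxrank0 // => v.
  by rewrite submx0 => /eqP ->; exact: submod0 (Fs _ FP0).
have bp k : p k -> (k <= n)%N.
  by case/asboolP => P [A [_ <- _]]; exact: rank_leq_col.
case: (ex_maxnP ep bp) => k /asboolP[P [A [FP Ak AP]]] kmax.
have max Q : F Q -> (forall v : 'rV_n, (v <= A)%MS -> Q v) ->
    Q `<=` [set v | (v <= A)%MS].
  move=> FQ AQ v Qv /=; rewrite -[(v <= A)%MS]negbK; apply/negP => vA.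
  (* A vector of [Q] outside the row space of [A] could be added to [A], giving a larger rank still
     inside [Q]. *)
  have : (A < A + v)%MS.
    rewrite ltmxE addsmxSl /=; apply: contra vA => AvA.
    exact: submx_trans (addsmxSr A v) AvA.
  move/rank_ltmx; rewrite Ak ltnNge => /negP; apply; apply: kmax.
  apply/asboolP; exists Q, (A + v)%MS; split=> // w /sub_addsmxP[[u1 u2] ->] /=.
  apply: (submodD (Fs _ FQ)); first by apply: AQ; exact: submxMl.
  by rewrite [u2]mx11_scalar mul_scalar_mx; by apply: (submodZ _ (Fs _ FQ)).
have PE : [set v | (v <= row_base A)%MS] = P.
  apply/seteqP; split=> v /=; rewrite eq_row_base; first exact: AP.
  exact: max FP AP v.
exists (\rank A), (row_base A); rewrite PE; split=> //.
  exact: row_base_free.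
move=> Q FQ PQ v Qv; rewrite -PE /= eq_row_base.
by apply: (max Q FQ) => // w wA; apply/PQ/AP.
Qed.

(** * Quotients of finite dimension *)

Section FiniteQuotients.
Context {K : numFieldType} {V : normedModType K}.
Implicit Types (Y Z : set V).

(** A subspace between [Y] and [J] is determined by the coordinates of its elements modulo [Y], so a
    maximal coordinate subspace yields a maximal member. *)
Lemma quotient_dim_maximal Y J n (F : set (set V)) :
    quotient_dim J Y n -> F !=set0 ->
    (forall I, F I -> [/\ submod_closed (mem I), Y `<=` I & I `<=` J]) ->
  exists2 I, F I & forall I', F I' -> I `<=` I' -> I' `<=` I.
Proof.
move=> [e [_ eP]] [I0 FI0] FP.
pose P := [set lincomb e @^-1` I | I in F].
have P0 : P !=set0 by exists (lincomb e @^-1` I0); exists I0.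
have Ps Q : P Q -> submod_closed (mem Q).
  by case=> I FI <-; apply: submod_preimage; case: (FP I FI).
have [k [A [_ [I FI IA] Amax]]] := rowspace_maximal P0 Ps.
exists I => // I' FI' II' v I'v.
have [Is YI _] := FP I FI; have [I's YI' I'J] := FP I' FI'.
have [c [Yc _]] := eP v (I'J v I'v).
(* The first summand is in [Y], hence in [I]; the second is in [I'], hence in [I] by maximality of
   the coordinate subspace. *)
rewrite -[v](subrK (lincomb e c)); apply: submodD => //; first exact: YI.
have : (lincomb e @^-1` I') c.
  rewrite /= -[lincomb e c](subKr v); apply: submodB => //; exact: YI'.
move=> I'c; suff : (lincomb e @^-1` I) c by [].
rewrite IA; apply: (Amax (lincomb e @^-1` I')) I'c; first by exists I'.
by rewrite -IA => d /= /II'.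
Qed.

(** The map [f] embeds the quotient of the preimages into [Z / Y]. The dimension [m] may be 0
    here. *)
Lemma quotient_dim_preimage (W : normedModType K) (f : {linear W -> V}) Z Y n :
    submod_closed (mem Z) -> submod_closed (mem Y) -> quotient_dim Z Y n ->
  exists m, quotient_dim (f @^-1` Z) (f @^-1` Y) m.
Proof.
move=> Zs Ys [e [Ze eP]].
(* The image of this embedding in coordinates; a basis of it, the rows of [A], is lifted to [e'] in
   [W]. *)
pose P := [set c : 'rV[K]_n | exists w, Z (f w) /\ Y (f w - lincomb e c)].
have Ps : submod_closed (mem P).
  apply/submod_closed_setP; split.
    by exists 0; rewrite linear0 lincomb0 subr0; split; exact: submod0.
  move=> a c d [u [Zu Yu]] [w [Zw Yw]]; exists (a *: u + w); split.
    by rewrite linearP; apply: submodD => //; exact: submodZ.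
  rewrite linearP lincomb_linear opprD addrACA -scalerBr.
  by apply: submodD => //; exact: submodZ.
have P1s Q : [set P] Q -> submod_closed (mem Q) by move=> ->.
have [k [A [Afree PA _]]] := rowspace_maximal (ex_intro _ P erefl) P1s.
have rowP i : exists w, Z (f w) /\ Y (f w - lincomb e (row i A)).
  by suff : P (row i A) by []; rewrite -PA /=; exact: row_sub.
have [e' e'P] := choice rowP.
have e'A (d : 'rV[K]_k) : Y (f (lincomb e' d) - lincomb e (d *m A)).
  rewrite lincomb_mulmx linear_sum -sumrB; apply: submod_sum => // i.
  by rewrite linearZ -scalerBr; apply: submodZ => //; case: (e'P i).
exists k, e'; split=> [i|w Zw]; first by case: (e'P i).
have [c [Yc _]] := eP _ Zw.
have : P c by exists w.
rewrite -PA /= => /submxP[d cE]; exists d; split.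
  rewrite /= linearB -[f w](subrK (lincomb e c)) cE.
  rewrite -addrA -[lincomb e _ - _]opprB.
  by apply: submodB => //; [rewrite -cE|exact: (e'A d)].
(* Both [d *m A] and [d' *m A] are coordinates of [f w] in the basis [e], so they agree. *)
move=> d' /=; rewrite linearB => Yd'; apply: (row_free_inj Afree).
have [c' [_ c'P]] := eP _ Zw.
rewrite -cE -(c'P _ Yc); apply: c'P.
rewrite -[f w](subrK (f (lincomb e' d'))) -addrA.
exact: submodD.
Qed.

Lemma quotient_dim_proper Y n : submod_closed (mem Y) ->
  quotient_dim Y Y n -> n = 0%N.
Proof.
case: n => // n Ys [e [Ye eP]]; have [c [_ cP]] := eP 0 (submod0 Ys).
(* All combinations of the [e i] lie in [Y], so every vector is a coordinate vector of 0; for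
   positive length, 0 and the all-ones vector contradict uniqueness. *)
have cE d : c = d.
  apply: cP; apply: submodB => //; first exact: submod0.
  by apply: submod_sum => // i; exact: submodZ.
have /eqP := etrans (esym (cE 0)) (cE (const_mx 1)).
by move/eqP/rowP/(_ 0); rewrite !mxE => /esym/eqP; rewrite oner_eq0.
Qed.

Lemma quotient_dim0_sub Z Y : quotient_dim Z Y 0 -> Z `<=` Y.
Proof.
by move=> [e [_ eP]] z /eP[c [+ _]]; rewrite big_ord0 subr0.
Qed.

End FiniteQuotients.

(** * Joins and greatest elements in lower finite-gap chains *)

Section Families.
Context {K : numFieldType} {V : normedModType K}.
Implicit Types (G C : set (set V)) (Y : set V).

Lemma join_family_sub G Y : closed_subspace Y ->
  (forall I, G I -> I `<=` Y) -> join_family G `<=` Y.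
Proof.
move=> [Yc Ys] GY; apply: subset_trans Yc; apply: closure_subset => v; apply.
by split=> // u [I GI Iu]; exact: GY Iu.
Qed.

Lemma sub_join_family G I : G I -> I `<=` join_family G.
Proof.
move=> GI v Iv; apply: subset_closure => Y [_ GY]; apply: GY.
by exists I.
Qed.

Lemma join_family_greatest G Y : closed_subspace Y -> G Y ->
  (forall I, G I -> I `<=` Y) -> join_family G = Y.
Proof.
by move=> Ys GY Ymax; apply/seteqP; split;
  [exact: join_family_sub | exact: sub_join_family].
Qed.

Lemma lower_finite_gap_greatest C G : C `<=` closed_subspace ->
    chain_family C -> complete_family C -> lower_finite_gap C ->
    subfamily C G ->
  exists2 J, G J & forall I, G I -> I `<=` J.
Proof.
move=> Cs Cch [Cmeet Cjoin] Cgap [[I0 GI0] GC]; set J := join_family G.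
have CJ : C J by rewrite Cjoin; left; exists G => //; split=> //; exists I0.
(* If [J] is the bottom of [C], all members of [G] coincide with it and any of them is greatest. *)
have [J0|J0] := pselect (J = meet_family C).
  exists I0 => // I GI; apply: subset_trans (sub_join_family GI) _.
  by rewrite -/J J0 => v; apply; exact: GC.
have [Y [CY YJ [n [n0 Yn]]]] := Cgap J CJ J0.
(* Otherwise all members of [G] would lie in [Y], and so would their join [J], contradicting the
   positive gap. *)
have [I1 GI1 YI1] : exists2 I, G I & Y `<=` I.
  apply: contrapT => nG; have JY : J `<=` Y.
    apply: join_family_sub; first exact: Cs.
    move=> I GI; have [//|YI] := Cch _ _ (GC _ GI) CY.
    by case: nG; exists I.
  have YE : Y = J by apply/seteqP; split.
  by move: Yn n0; rewrite YE => /(quotient_dim_proper (Cs _ CJ).2) ->.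
have [||I [GI YI] Imax] :=
  quotient_dim_maximal (F := G `&` [set I | Y `<=` I]) Yn.
- by exists I1.
- move=> I [GI YI]; split=> //; last exact: sub_join_family.
  exact: (Cs _ (GC _ GI)).2.
(* In a chain, an element maximal among the members above [Y] is greatest in all of [G]. *)
exists I => // I' GI'; have [//|II'] := Cch _ _ (GC _ GI') (GC _ GI).
by apply: Imax => //; split=> //; exact: subset_trans II'.
Qed.

End Families.

(** * Pulling a chain back along an injective continuous linear map *)

Lemma closed_subspace_preimage (K : numFieldType) (V W : normedModType K)
    (f : {linear W -> V}) (Y : set V) :
  continuous f -> closed_subspace Y -> closed_subspace (f @^-1` Y).
Proof.
move=> fc [Yc Ys]; split; last exact: submod_preimage.
by apply: preimage_closed => // x _; exact: fc.
Qed.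

Section Preimage.
Context {K : numFieldType} {V W : normedModType K} (f : {linear W -> V}).
Hypothesis f_continuous : continuous f.
Hypothesis f_inj : injective f.
Variable C : set (set V).
Hypotheses (C0 : C !=set0) (Cs : C `<=` closed_subspace).
Hypotheses (Cchain : chain_family C) (Ccomplete : complete_family C).
Hypotheses (Cgap : lower_finite_gap C) (Cbetween : between C [set 0] setT).

Let D : set (set W) := [set f @^-1` I | I in C].

Let Ds : D `<=` closed_subspace.
Proof.
by move=> _ [I CI <-]; apply: closed_subspace_preimage => //; exact: Cs.
Qed.

Lemma chain_preimage : chain_family D.
Proof.
move=> _ _ [I CI <-] [J CJ <-].
by have [IJ|JI] := Cchain CI CJ; [left|right]; exact: preimage_subset.
Qed.

(** Different members of [C] may have the same preimage. Taking all of them makes the meet over a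
    singleton [G] the smallest member with the given preimage. *)
Let preimages (G : set (set W)) : set (set V) := C `&` [set I | G (f @^-1` I)].

Let preimages_subfamily G : subfamily D G -> subfamily C (preimages G).
Proof.
move=> [[Z GZ] GD]; split; last by move=> I [].
by have [I CI IZ] := GD _ GZ; exists I; split=> //=; rewrite IZ.
Qed.

Let C_meet G : subfamily C G -> C (meet_family G).
Proof. by move=> CG; rewrite Ccomplete.1; left; exists G. Qed.

Let meet_preimages G : subfamily D G ->
  meet_family G = f @^-1` meet_family (preimages G).
Proof.
move=> DG; apply/seteqP; split=> w Gw.
  by move=> I [CI GI]; exact: Gw GI.
by move=> Z GZ; have [I CI IZ] := DG.2 _ GZ; rewrite -IZ;
  apply: Gw; split=> //=; rewrite IZ.
Qed.

Let D_greatest G : subfamily D G -> exists2 J, G J & join_family G = J.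
Proof.
move=> DG; have [J [CJ GJ] Jmax] := lower_finite_gap_greatest Cs Cchain
  Ccomplete Cgap (preimages_subfamily DG).
exists (f @^-1` J) => //; apply: join_family_greatest => //.
  by apply: Ds; exists J.
move=> Z GZ; have [I CI IZ] := DG.2 _ GZ; rewrite -IZ.
by apply: preimage_subset; apply: Jmax; split=> //=; rewrite IZ.
Qed.

Let D_self : subfamily D D.
Proof. by split=> //; case: C0 => I CI; exists (f @^-1` I); exists I. Qed.

Let D_set1 Z : D Z -> subfamily D [set Z].
Proof. by move=> DZ; split=> [|_ ->//]; exists Z. Qed.

Let D_meet G : subfamily D G -> D (meet_family G).
Proof.
move=> DG; rewrite meet_preimages //; eexists; last by [].
exact/C_meet/preimages_subfamily.
Qed.

Let D_join G : subfamily D G -> D (join_family G).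
Proof. by move=> DG; have [J GJ ->] := D_greatest DG; exact: DG.2. Qed.

(** Singleton subfamilies show that each member is a meet and a join; the converse is closure under
    both, applied to [D] itself for the two adjoined extremes. *)
Lemma complete_preimage : complete_family D.
Proof.
split; apply/seteqP; split=> Z.
- by move=> DZ; left; exists [set Z]; [exact: D_set1|exact: bigcap_set1].
- by move=> [[G DG <-]|->]; [exact: D_meet|exact: D_join].
- move=> DZ; left; exists [set Z]; first exact: D_set1.
  by have [_ ->] := D_greatest (D_set1 DZ).
- by move=> [[G DG <-]|->]; [exact: D_join|exact: D_meet].
Qed.

Lemma between_preimage : between D [set 0] setT.
Proof.
(* The whole space is the join of [C], so completeness makes it a member, and its preimage is all of
   [W]. *)
have CT : C setT.
  by rewrite -Cbetween.2 {1}Ccomplete.1; right.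
split; last first.
  by apply/seteqP; split=> // w _; apply: (@sub_join_family _ _ D setT);
    [exists setT|].
apply/seteqP; split=> w.
  move=> Dw; apply: f_inj; rewrite linear0.
  suff : meet_family C (f w) by rewrite Cbetween.1.
  by move=> I CI; apply: (Dw (f @^-1` I)); exists I.
by move=> -> _ [I CI <-] /=; rewrite linear0; exact: submod0 (Cs CI).2.
Qed.

Lemma lower_finite_gap_preimage : lower_finite_gap D.
Proof.
move=> Z DZ Z0.
pose I := meet_family (preimages [set Z]).
have ZI : f @^-1` I = Z.
  by rewrite -meet_preimages; [exact: bigcap_set1|exact: D_set1].
have CI : C I by apply/C_meet/preimages_subfamily/D_set1.
(* If [I] were the bottom 0 of [C], injectivity would make [Z] the bottom 0 of [D]. *)
have I0 : I <> meet_family C.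
  move=> I0; apply: Z0; rewrite -ZI I0 Cbetween.1 between_preimage.1.
  apply/seteqP; split=> w /=; last by move=> ->; rewrite linear0.
  by rewrite -(linear0 f) => /f_inj.
have [Y [CY YI [n [n0 Yn]]]] := Cgap CI I0.
have [m Ym] := quotient_dim_preimage f (Cs CI).2 (Cs CY).2 Yn.
have YZ : f @^-1` Y `<=` Z by rewrite -ZI; exact: preimage_subset.
exists (f @^-1` Y); split=> //; first by exists Y.
rewrite ZI in Ym; exists m; split=> //; rewrite lt0n; apply/eqP => m0.
move: Ym; rewrite m0 => /quotient_dim0_sub ZY.
(* With [m = 0], [Y] also has preimage [Z], so it contains the smallest such member [I]; then
   [Y = I], against [0 < n]. *)
have IY : I `<=` Y.
  by move=> v; apply; split=> //; apply/seteqP; split; [exact: YZ|exact: ZY].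
have YE : Y = I by apply/seteqP; split.
by move: Yn n0; rewrite YE => /(quotient_dim_proper (Cs CI).2) ->.
Qed.

End Preimage.

(** * The inclusion of the subalgebra *)

Lemma subalg_val_continuous (R : realType) (L : banachLieType R)
  (M : closedLieSubalgebra L) : continuous (val : subalg M -> L).
Proof.
move=> x; have FF : Filter (nbhs x) by exact: nbhs_filter.
apply/(@cvgrPdist_lt _ L _ _ FF) => e e0.
have /(@cvgrPdist_lt _ (subalg M) _ _ FF)/(_ e e0) := @cvg_id _ (nbhs x).
by apply: filterS => y; rewrite subalg_normE raddfB.
Qed.

Theorem corollary8p22 (R : realType) (L : banachLieType R)
    (M : closedLieSubalgebra L) :
  strongly_F_semisimple L -> strongly_F_semisimple (subalg M).
Proof.
move=> [C [[C0 Cideal] Cchain Ccomplete Cgap Cbetween]].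
have Cs : C `<=` closed_subspace by move=> I /Cideal[].
pose f : {linear subalg M -> L} := val.
have fc : continuous f by exact: subalg_val_continuous.
have fI : injective f by exact: val_inj.
exists [set f @^-1` I | I in C]; split.
- split; first by case: C0 => I CI; exists (f @^-1` I); exists I.
  move=> _ [I CI <-]; have [Is Ilie] := Cideal _ CI.
  (* The inclusion carries [sub_lie] to [lie] by computation, so preimages of ideals are ideals. *)
  by split=> [|a x]; [exact: closed_subspace_preimage|exact: Ilie].
- exact: chain_preimage.
- exact: complete_preimage.
- exact: lower_finite_gap_preimage.
- exact: between_preimage.
Qed.
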